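(* Let $U$ be an optimal prefix-free machine and let $f:2^\omega\to[0,1]$, $f(x)=\sum_{\sigma\le_L x}2^{-K_U(\sigma)}$. Then $f(2^\omega)$ is null (of Lebesgue measure zero), nowhere dense and perfect.
   Context: A machine is a partial computable function $M$ from $2^{<\omega}$ to $2^{<\omega}$; it is prefix-free if its domain is a prefix-free set. $K_M(\sigma)=\min\{|\tau|: M(\tau)=\sigma\}$ ($=\infty$ if there is no such $\tau$, with $2^{-\infty}=0$). A prefix-free machine $U$ is optimal if for each prefix-free machine $M$ there is a constant $c$ with $K_U(\sigma)\le K_M(\sigma)+c$ for all $\sigma$. For $\sigma\in 2^{<\omega}$ and $x\in 2^\omega$, $\sigma<_L x$ means that there is $n$ with $\sigma\upharpoonright n=x\upharpoonright n$, $\sigma(n)=0$ and $x(n)=1$; $\sigma\le_L x$ means that $\sigma<_L x$ or $\sigma$ is an initial segment of $x$. A class of reals is nowhere dense if its closure has empty interior; it is perfect if it is closed and contains no isolated point. *)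

(* Defs.v *)
From HB Require Import structures.
From mathcomp Require Import all_boot all_order all_algebra.
From mathcomp Require Import all_classical all_reals all_analysis.
Set Implicit Arguments.
Unset Strict Implicit.
Unset Printing Implicit Defensive.
Import Order.TTheory GRing.Theory Num.Theory.
Import numFieldNormedType.Exports.
Local Open Scope classical_set_scope.
Local Open Scope ring_scope.

(* Partial computability on nat is Kleene's: programs for the mu-recursive
   functions of each arity. *)
Inductive mu_rec : nat -> Type :=
| Zero n : mu_rec n
| Succ : mu_rec 1
| Proj n (i : 'I_n) : mu_rec n
| Comp m n (g : mu_rec m) (h : 'I_m -> mu_rec n) : mu_rec n
| PrimRec n (g : mu_rec n) (h : mu_rec n.+2) : mu_rec n.+1
| Mu n (g : mu_rec n.+1) : mu_rec n.

(* [computes e v y]: the program [e] halts on input [v] with output [y]. *)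
Fixpoint computes n (e : mu_rec n) : n.-tuple nat -> nat -> Prop :=
  match e in mu_rec n return n.-tuple nat -> nat -> Prop with
  | Zero _ => fun _ y => y = 0%N
  | Succ => fun v y => y = (thead v).+1
  | Proj _ i => fun v y => y = tnth v i
  | Comp m _ g h => fun v y =>
      exists2 w : m.-tuple nat,
        forall i, computes (h i) v (tnth w i) & computes g w y
  | PrimRec _ g h => fun v =>
      (fix iterate (k : nat) (y : nat) : Prop :=
         if k is k'.+1 then
           exists2 z, iterate k' z &
             computes h [tuple of k' :: z :: [tuple of behead v]] y
         else computes g [tuple of behead v] y) (thead v)
  | Mu _ g => fun v y =>
      computes g [tuple of y :: v] 0%N /\
      forall z, (z < y)%N -> exists u, computes g [tuple of z :: v] u.+1
  end.

(* Finite binary strings are identified with the natural numbers by the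
   length-lexicographic bijection: the binary expansion of [code s + 1] is
   a leading 1 followed by [s] (false = 0, true = 1). *)
Definition code (s : seq bool) : nat :=
  foldl (fun n (b : bool) => (n.*2 + b).+1)%N 0%N s.

(* A partial function on strings; [None] means undefined. *)
Definition partial_fun := seq bool -> option (seq bool).

Definition machine (M : partial_fun) : Prop :=
  exists e : mu_rec 1,
    forall s t, M s = Some t <-> computes e [tuple code s] (code t).

Definition prefix_free (D : set (seq bool)) : Prop :=
  forall s t, D s -> D t -> prefix s t -> s = t.

Definition prefix_free_machine (M : partial_fun) : Prop :=
  machine M /\ prefix_free [set s | isSome (M s)].

Definition has_program (M : partial_fun) (s : seq bool) (n : nat) : bool :=
  [exists t : n.-tuple bool, M t == Some s].

Definition K (R : realType) (M : partial_fun) (s : seq bool) : \bar R :=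
  if pselect (exists n, has_program M s n) is left ex_prog
  then ((ex_minn ex_prog)%:R)%:E else +oo%E.

Definition optimal (R : realType) (U : partial_fun) : Prop :=
  prefix_free_machine U /\
  forall M, prefix_free_machine M ->
    exists c : nat, forall s, (K R U s <= K R M s + (c%:R)%:E)%E.

(* [2 ^ (- k)], with [2 ^ (- oo) = 0]; the value at [-oo] is irrelevant. *)
Definition exp2N (R : realType) (k : \bar R) : R :=
  if k is r%:E then 2 `^ (- r) else 0.

Definition lexlt (s : seq bool) (x : nat -> bool) : Prop :=
  exists n, [/\ (n < size s)%N, take n s = mkseq x n,
                nth false s n = false & x n = true].

Definition lexle (s : seq bool) (x : nat -> bool) : Prop :=
  lexlt s x \/ s = mkseq x (size s).

Definition Omega_le_sum (R : realType) (U : partial_fun) (x : nat -> bool) : \bar R :=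
  (\esum_(s in [set s | lexle s x]) (exp2N (K R U s))%:E)%E.

Definition Omega_le (R : realType) (U : partial_fun) (x : nat -> bool) : R :=
  fine (Omega_le_sum R U x).

Definition nowhere_dense (T : topologicalType) (A : set T) : Prop :=
  interior (closure A) = set0.

Definition perfect (T : topologicalType) (A : set T) : Prop :=
  closed A /\ isolated A = set0.

(* Main.v *)
Require Import Defs.
From mathcomp Require Import all_boot all_order all_algebra.
From mathcomp Require Import all_classical all_reals all_analysis.
From mathcomp Require Import measurable_realfun lra zify.
Import Order.TTheory GRing.Theory Num.Theory.
Import numFieldNormedType.Exports.
Local Open Scope classical_set_scope.
Local Open Scope ring_scope.

(** Write w(s) = 2^(-K_U(s)) and f(x) for the sum of w over the strings
    s <=_L x. The total weight is at most 1 by the Kraft inequality applied to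
    shortest programs ([kraft_esum]).

    Whether s <=_L x holds depends only on the first |s| bits of x. So if x and
    y agree on n bits, then f(x) and f(y) differ by at most the weight tail(n)
    of the strings longer than n, which tends to 0. Hence f is continuous on
    Cantor space ([lex_cdf_continuous]) and its range is compact, thus closed.

    More precisely, for a string t of length n the image of the cylinder of t
    lies in an interval that starts at f(t000...) and whose length is the
    weight of the strings that properly extend t ([lex_cdf_near]). Different t
    have disjoint sets of extensions, so these 2^n intervals have total length
    at most tail(n): the range is null. A closed null set has empty interior.

    Optimality of U excludes isolated points of the range. Comparing U
    with a machine whose only computation maps the empty program to s shows
    that K_U(s) is finite, so w(s) > 0 for every s ([optimal_K_fin]). Flipping
    bit n of x then changes f(x), since some string is counted on one side only
    ([lex_cdf_flip]), but by at most tail(n). *)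

(** * The order between strings and infinite sequences *)

(** A decision procedure for [lexle] by recursion on the string, which makes
    the facts below provable by structural induction. *)
Fixpoint lexleb (s : seq bool) (x : nat -> bool) : bool :=
  if s is b :: s' then
    (~~ b && x 0%N) || ((b == x 0%N) && lexleb s' (x \o succn))
  else true.

Lemma mkseqS_comp (T : Type) (x : nat -> T) n :
  mkseq x n.+1 = x 0%N :: mkseq (x \o succn) n.
Proof. by rewrite /mkseq /= -[1%N]addn0 iotaDl -map_comp. Qed.

Lemma lexlt_cons b s x :
  lexlt (b :: s) x <-> (~~ b /\ x 0%N) \/ (b = x 0%N /\ lexlt s (x \o succn)).
Proof.
split.
  case=> [[|n]] [/= lt_n e sn xn]; first by left; rewrite sn.
  by move: e; rewrite mkseqS_comp => -[-> e]; right; split=> //; exists n; split.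
case=> [[/negbTE -> x0]|[-> [n [lt_n e sn xn]]]]; first by exists 0%N; split.
by exists n.+1; split=> //=; rewrite e mkseqS_comp.
Qed.

Lemma lexleP s x : lexle s x <-> lexleb s x.
Proof.
elim: s x => [|b s IHs] x /=; first by split=> // _; right.
split.
  case=> [/lexlt_cons[[-> ->]//|[-> /or_introl/IHs ->]]|]; first by rewrite eqxx orbT.
  by rewrite [size _]/= mkseqS_comp => -[-> /or_intror/IHs ->]; rewrite eqxx orbT.
case/orP => [/andP H|/andP[/eqP -> /IHs[H|H]]].
- by left; apply/lexlt_cons; left.
- by left; apply/lexlt_cons; right.
- by right; rewrite [size _]/= mkseqS_comp -H.
Qed.

(** Let t be the common prefix of length n of x and y. A string s that is
    not a proper extension of t is either compared with t at a bit below n or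
    is a prefix of t, so the remaining bits of x and y are not looked at. *)
Lemma lexle_agree n s x y : (forall i, (i < n)%N -> x i = y i) ->
  ~~ ((n < size s)%N && (take n s == mkseq x n)) -> lexle s x -> lexle s y.
Proof.
rewrite !lexleP; elim: s n x y => [|b s IHs] [|n] x y //= agree.
rewrite ltnS mkseqS_comp eqseq_cons -agree//; case: eqP => //= -> out.
by rewrite orbC andNb => /orP[/(IHs n _ (y \o succn) _ out) -> //|//] i ?; apply: agree.
Qed.

(** If x is below y at every bit then, at the first bit where they differ, x
    has 0 and y has 1. *)
Lemma lexle_mono s (x y : nat -> bool) : (forall i, x i -> y i) -> lexle s x -> lexle s y.
Proof.
rewrite !lexleP; elim: s x y => [|b s IHs] x y //= le_xy.
have/IHs IH : forall i, (x \o succn) i -> (y \o succn) i by move=> i; apply: le_xy.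
have := le_xy 0%N; case: (x 0%N) => [-> //|_]; last first.
  by case: (y 0%N); case: b => //= /IH ->.
by case: b => //= /IH.
Qed.

Lemma lexle_mkseq x n : lexle (mkseq x n) x.
Proof. by right; rewrite size_mkseq. Qed.

(** With [lexle_mkseq] this provides a string that separates y from a
    lexicographically smaller x. *)
Lemma lexle_mkseqS x y n : (forall i, (i < n)%N -> x i = y i) ->
  x n = false -> y n = true -> ~ lexle (mkseq y n.+1) x.
Proof.
rewrite lexleP; elim: n x y => [|n IHn] x y agree xn yn; rewrite mkseqS_comp /=.
  by rewrite xn yn.
rewrite -agree//= andNb eqxx /=; apply: IHn => // i lt_in.
exact: agree.
Qed.

(** * The Kraft inequality *)

Lemma kraft_sum_behead (R : realFieldType) (b : bool) (D : seq (seq bool)) :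
  \sum_(t <- D | ohead t == Some b) (2^-1 : R) ^+ size t =
  2^-1 * \sum_(t <- [seq behead t | t <- D & ohead t == Some b]) 2^-1 ^+ size t.
Proof.
rewrite big_map big_filter mulr_sumr; apply: eq_bigr => -[|c t] //= _.
by rewrite exprS.
Qed.

(** By induction on the maximal length: unless the empty string occurs, and
    then it is the only one, the strings split according to their first bit;
    deleting that bit keeps each half prefix-free and doubles its sum. *)
Lemma kraft (R : realFieldType) (D : seq (seq bool)) : uniq D ->
  {in D &, forall s t, prefix s t -> s = t} ->
  \sum_(t <- D) (2^-1 : R) ^+ size t <= 1.
Proof.
have [n] : exists n, forall t, t \in D -> (size t <= n)%N.
  by exists (\max_(t <- D) size t)%N => t tD; apply: leq_bigmax_seq.
elim: n D => [|n IHn] D szD uD pfD.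
  have [->|] := eqVneq D [::]; first by rewrite big_nil.
  case: D szD uD {pfD} => // u [|v D] szD; first by
    rewrite big_seq1 exprn_ile1 ?invr_ge0// invf_le1 ?ler1n.
  have /eqP : size u == 0%N by rewrite -leqn0 szD ?mem_head.
  have /eqP : size v == 0%N by rewrite -leqn0 szD ?inE ?eqxx ?orbT.
  by move=> /size0nil -> /size0nil ->.
have [nilD|nilD] := boolP ([::] \in D).
  rewrite (perm_big [:: [::]]) /= ?big_seq1//; apply: uniq_perm => // t.
  rewrite inE; apply/idP/eqP => [tD|-> //].
  by rewrite -(pfD _ _ nilD tD)// prefix0s.
have half b : \sum_(t <- D | ohead t == Some b) (2^-1 : R) ^+ size t <= 2^-1.
  have mem t : t \in [seq behead t | t <- D & ohead t == Some b] -> b :: t \in D.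
    by case/mapP => -[|c u]; rewrite mem_filter //= => /andP[/eqP[->] uD' ->].
  rewrite kraft_sum_behead ler_piMr ?invr_ge0//; apply: IHn.
  - by move=> t /mem /szD.
  - rewrite map_inj_in_uniq ?filter_uniq// => -[|c u] [|d v];
      rewrite !mem_filter //= => /andP[/eqP[->] _] /andP[/eqP[->] _] -> //.
  - move=> s t /mem sD /mem tD pst.
    by have [] : b :: s = b :: t by apply: pfD => //=; rewrite eqxx.
rewrite (bigID (fun t => ohead t == Some true)) /=.
rewrite [X in _ + X](_ : _ = \sum_(t <- D | ohead t == Some false) 2^-1 ^+ size t).
  by have := half true; have := half false; lra.
rewrite big_seq_cond [RHS]big_seq_cond; apply: eq_bigl => -[|[] t] //=.
by rewrite (negbTE nilD).
Qed.

(** * The weights of the strings *)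

Lemma exp2N_ge0 (R : realType) (k : \bar R) : 0 <= exp2N k.
Proof. by case: k => [r| |] //=; apply: powR_ge0. Qed.

Lemma exp2N_gt0 (R : realType) (k : \bar R) : (0 <= k < +oo)%E -> 0 < exp2N k.
Proof. by case: k => [r _| |] //=; rewrite ?powR_gt0// ltxx andbF. Qed.

Lemma shortest_program (R : realType) M s : exp2N (K R M s) = 0 \/
  exists2 t, M t = Some s & exp2N (K R M s) = 2^-1 ^+ size t.
Proof.
rewrite /K; case: pselect => [ex_prog|_]; last by left.
case: ex_minnP => n /existsP[t /eqP Mt] _; right; exists t => //.
by rewrite size_tuple /= powRN powR_mulrn// exprVn.
Qed.

(** Distinct strings have distinct shortest programs, and all programs lie in
    the prefix-free domain of M. *)
Lemma kraft_programs (R : realType) M (r : seq (seq bool)) :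
  prefix_free [set t | isSome (M t)] -> uniq r ->
  \sum_(s <- r) exp2N (K R M s) <= 1.
Proof.
move=> pfM ur.
suff [D [uD MD ->]] : exists D, [/\ uniq D,
    {in D, forall t, exists2 s, s \in r & M t = Some s} &
    \sum_(s <- r) exp2N (K R M s) = \sum_(t <- D) 2^-1 ^+ size t].
  apply: kraft => // s t /MD[a _ Ms] /MD[b _ Mt]; apply: pfM => /=.
    by rewrite Ms.
  by rewrite Mt.
elim: r ur => [_|s r IHr /= /andP[sr /IHr[D [uD MD sumD]]]].
  by exists [::]; rewrite !big_nil.
have sub t : t \in D -> exists2 s', s' \in s :: r & M t = Some s'.
  by move=> /MD[s' s'r Mt]; exists s'; rewrite // inE s'r orbT.
rewrite big_cons sumD.
have [->|[t Mt ->]] := shortest_program R M s; first by rewrite add0r; exists D.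
exists (t :: D); rewrite big_cons /=; split=> //.
  rewrite uD andbT; apply/negP => /MD[s' s'r].
  by rewrite Mt => -[ss']; rewrite ss' s'r in sr.
by move=> u; rewrite inE => /predU1P[->|/sub//]; exists s; rewrite ?mem_head.
Qed.

Lemma kraft_esum (R : realType) M (A : set (seq bool)) :
  prefix_free [set t | isSome (M t)] ->
  (\esum_(s in A) (exp2N (K R M s))%:E <= 1)%E.
Proof.
move=> pfM; apply: ge_ereal_sup => _ [X [finX _] <-].
by rewrite fsbig_finite//= sumEFin lee_fin kraft_programs// finmap.fset_uniq.
Qed.

Lemma code_rcons s b : Defs.code (rcons s b) = ((Defs.code s).*2 + b).+1.
Proof. by rewrite /Defs.code foldl_rcons. Qed.

(** The parity of a code determines the last bit, because
    [code (rcons s b)] is 2 * [code s] + b + 1. *)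
Lemma code_inj : injective Defs.code.
Proof.
elim/last_ind => [|s b IHs] t; case/lastP: t => [|t c] //; rewrite ?code_rcons //.
move=> e; have [/IHs -> ->] // : Defs.code s = Defs.code t /\ b = c.
by move: e; case: b; case: c; lia.
Qed.

(** Minimization of the second projection (z, s) |-> s searches for the first z
    with s = 0: it stops at once with value 0 if s = 0 and diverges otherwise.
    Composing it with k successors yields the value k. *)
Lemma computes_at0 k : exists e : mu_rec 1,
  forall s y, computes e [tuple s] y <-> s = 0%N /\ y = k.
Proof.
elim: k => [|k [e eP]].
  exists (Mu (Proj (lift ord0 ord0 : 'I_2))) => s y /=.
  split=> [[s0 small]|[-> ->]]; last by split.
  have s0' : s = 0%N := esym s0.
  by split=> //; case: y small {s0} => // y /(_ 0%N isT)[u]; rewrite /tnth /= s0'.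
exists (Comp Succ (fun _ : 'I_1 => e)) => s y /=; split.
  by move=> [w /(_ ord0)/eP[-> w0] ->]; split=> //; rewrite /thead w0.
move=> [-> ->]; exists [tuple k] => [i|//].
by rewrite ord1; apply/eP.
Qed.

(** The machine defined only on the empty program, with value s, gives s
    complexity 0, so K_U(s) is at most the constant of that machine. *)
Lemma optimal_K_fin (R : realType) U s : optimal R U -> (0 <= K R U s < +oo)%E.
Proof.
move=> [_ optU].
pose M : partial_fun := fun t => if t == [::] then Some s else None.
have [|c /(_ s) le_c] := optU M.
  split.
    have [e eP] := computes_at0 (Defs.code s); exists e => t u; rewrite eP /M.
    split=> [|[/(@code_inj _ [::]) -> /code_inj ->] //].
    by case: eqP => // -> [->].
  by move=> t u; rewrite /M /=; case: eqP => // ->; case: eqP => // ->.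
have KM : (K R M s < +oo)%E.
  rewrite /K; case: pselect => [p|[]]; first by rewrite ltry.
  by exists 0%N; apply/existsP; exists [tuple].
apply/andP; split; first by rewrite /K; case: pselect => [p|_]; rewrite ?lee_fin ?ler0n.
apply: le_lt_trans le_c _; apply: lte_add_pinfty => //; exact: ltry.
Qed.

(** * Lebesgue measure of subsets of the line *)

Lemma lebesgue_measure_cover (R : realType) (A : set R) (r : seq (R * R)) :
  measurable A -> (forall p, p \in r -> 0 <= p.2) ->
  (forall a, A a -> exists2 p, p \in r & p.1 <= a <= p.1 + p.2) ->
  (lebesgue_measure A <= (\sum_(p <- r) p.2)%:E)%E.
Proof.
move=> mA r_ge0 cov.
pose I i : set R := `[(nth (0, 0) r i).1, (nth (0, 0) r i).1 + (nth (0, 0) r i).2]%classic.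
have mI i : measurable (I i) by exact: measurable_itv.
apply: (@le_trans _ _ (lebesgue_measure (\big[setU/set0]_(i < size r) I i))).
  apply: le_measure; rewrite ?inE//.
    by apply: bigsetU_measurable => i _; exact: mI.
  move=> a /cov[p pr ap]; rewrite -bigcup_mkord; exists (index p r) => /=.
    by rewrite index_mem.
  by rewrite /I nth_index//= in_itv.
apply: le_trans (Boole_inequality lebesgue_measure (fun i _ => mI i)) _.
rewrite (big_nth (0, 0)) big_mkord -sumEFin; apply: lee_sum => i _.
rewrite /= lebesgue_measure_itv /= lte_fin; case: ifP => _.
  by rewrite -EFinD addrAC subrr add0r.
by rewrite lee_fin r_ge0 ?mem_nth.
Qed.

(** An interior point would be the centre of a ball inside A, and balls have
    positive measure. *)
Lemma closed_null_nowhere_dense (R : realType) (A : set R) :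
  closed A -> (@lebesgue_measure R).-negligible A -> nowhere_dense A.
Proof.
move=> clA nulA; rewrite /nowhere_dense -((closure_id A).1 clA).
apply/seteqP; split=> // a /nbhs_ballP[e /= e0 subA].
have mA : measurable A by exact: closed_measurable.
have A0 : lebesgue_measure A = 0%E by apply/negligibleP.
have : (lebesgue_measure (ball a e) <= lebesgue_measure A)%E.
  by apply: le_measure; rewrite ?inE//; exact: measurable_ball.
by rewrite A0 (lebesgue_measure_ball _ (ltW e0)) lee_fin leNgt mulrn_wgt0.
Qed.

(** * Finite discrete masses *)

Section Mass.
Context {R : realType} {T : choiceType} (w : T -> R).
Hypothesis w_ge0 : forall s, 0 <= w s.
Hypothesis w_fin : (\esum_(s in setT) (w s)%:E < +oo)%E.

(** Finiteness of the total weight makes [fine] lossless here, so that the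
    estimates below take place in R. *)
Definition mass (A : set T) : R := fine (\esum_(s in A) (w s)%:E)%E.

Lemma massE A : (mass A)%:E = (\esum_(s in A) (w s)%:E)%E.
Proof.
have ge0 B : (0 <= \esum_(s in B) (w s)%:E)%E by apply: esum_ge0 => s _; rewrite lee_fin.
rewrite /mass fineK// ge0_fin_numE//; apply: le_lt_trans w_fin.
rewrite [leRHS](esumID A) ?setTI; last by move=> s _; rewrite lee_fin.
by rewrite leeDl.
Qed.

Lemma mass_ge0 A : 0 <= mass A.
Proof. by rewrite -lee_fin massE; apply: esum_ge0 => s _; rewrite lee_fin. Qed.

Lemma mass_split B A : mass A = mass (A `&` B) + mass (A `&` ~` B).
Proof.
by apply: EFin_inj; rewrite EFinD !massE; apply: esumID => s _; rewrite lee_fin.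
Qed.

Lemma mass_diff A B : A `<=` B -> mass B = mass A + mass (B `&` ~` A).
Proof. by move=> AB; rewrite (mass_split A B); have -> : B `&` A = A by apply/setIidPr. Qed.

Lemma mass_le A B : A `<=` B -> mass A <= mass B.
Proof. by move=> /mass_diff ->; rewrite lerDl mass_ge0. Qed.

Lemma mass_set1 s : mass [set s] = w s.
Proof. by apply: EFin_inj; rewrite massE esum_set1// lee_fin. Qed.

Lemma mass_fibers (I : eqType) (f : T -> I) A (r : seq I) : uniq r ->
  \sum_(i <- r) mass (A `&` [set s | f s = i]) <= mass A.
Proof.
elim: r A => [|i r IHr] A /=; first by rewrite big_nil mass_ge0.
move=> /andP[ir /IHr{}IHr]; rewrite big_cons (mass_split [set s | f s = i] A) lerD2l.
apply: le_trans (IHr (A `&` ~` [set s | f s = i])).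
rewrite big_seq [leRHS]big_seq; apply: ler_sum => j jr; apply: mass_le => s [As /= fs].
by split=> //; split=> //= fsi; rewrite -fsi fs jr in ir.
Qed.

(** A finite set X carries all but e of the mass, and for n beyond the values
    of h on X the tail is disjoint from X. *)
Lemma mass_tail (h : T -> nat) e : 0 < e ->
  exists n, mass [set s | (n < h s)%N] < e.
Proof.
move=> e0.
have fin : (\esum_(s in setT) (w s)%:E)%E \is a fin_num by rewrite -massE.
have [_ [X [finX _] <-]] := ub_ereal_sup_adherent e0 fin.
rewrite -/(esum _ _) -massE => ltX.
have /finite_seqP[r Xr] := finX.
exists (\max_(s <- r) h s)%N; set N := (\max_(s <- r) h s)%N.
pose A := [set s | (N < h s)%N]; rewrite -/A.
have XA : X `<=` ~` A.
  move=> s Xs /=; apply/negP; rewrite -leqNgt; apply: leq_bigmax_seq => //.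
  by move: Xs; rewrite Xr.
have := mass_le _ _ XA; rewrite -lee_fin massE esum_fset//; last first.
  by move=> s _; rewrite lee_fin.
move=> leX; have := lt_le_trans ltX leX.
by rewrite -EFinB lte_fin (mass_split A setT) !setTI; lra.
Qed.
End Mass.

(** * The range of the distribution function *)

Section Image.
Context {R : realType} (w : seq bool -> R).
Hypothesis w_ge0 : forall s, 0 <= w s.
Hypothesis w_fin : (\esum_(s in setT) (w s)%:E < +oo)%E.

Definition lex_cdf (x : nat -> bool) : R := mass w [set s | lexle s x].
Definition tail n : R := mass w [set s | (n < size s)%N].

Local Notation f := lex_cdf.

(** A string counted in f(x) but not in f(y) must properly extend the common
    prefix of x and y, by [lexle_agree]. *)
Lemma lex_cdf_near n x y : (forall i, (i < n)%N -> x i = y i) ->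
  f x <= f y + mass w ([set s | (n < size s)%N] `&` [set s | take n s = mkseq x n]).
Proof.
move=> agree; rewrite /lex_cdf (mass_split _ w_ge0 w_fin [set s | lexle s y] [set s | lexle s x]).
apply: lerD; apply: mass_le => // s [] //= sx sy.
apply: contrapT => out; apply: sy; apply: (lexle_agree n s x y agree) sx.
by apply/negP => /andP[ns /eqP ts]; apply: out; split.
Qed.

Lemma lex_cdf_tail n x y : (forall i, (i < n)%N -> x i = y i) ->
  `|f x - f y| <= tail n.
Proof.
have le u v : (forall i, (i < n)%N -> u i = v i) -> f u <= f v + tail n.
  move=> /lex_cdf_near/le_trans; apply; rewrite lerD2l.
  by apply: mass_le => // s [].
move=> agree; have := le _ _ agree; have /le : forall i, (i < n)%N -> y i = x i.
  by move=> i /agree.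
by rewrite ler_norml; lra.
Qed.

(** The string y(0)...y(n) is counted in f(y) but not in f(x), and everything
    counted in f(x) is counted in f(y). *)
Lemma lex_cdf_flip n x y : (forall i, i != n -> x i = y i) ->
  x n = false -> y n = true -> f x + w (mkseq y n.+1) <= f y.
Proof.
move=> agree xn yn.
have xy i : x i -> y i by have [->|/agree ->] := eqVneq i n; rewrite ?xn.
rewrite {2}/lex_cdf (mass_diff _ w_ge0 w_fin [set s | lexle s x]); last first.
  by move=> s; apply: lexle_mono.
rewrite lerD2l -(mass_set1 _ w_ge0 w_fin); apply: mass_le => // _ -> /=; split.
  exact: lexle_mkseq.
by apply: lexle_mkseqS => // i /ltn_eqF/negbT; apply: agree.
Qed.

(** Agreement with x on the first n bits defines a neighbourhood of x in Cantor
    space, and f varies by at most tail(n) on it. *)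
Lemma lex_cdf_continuous : continuous (f : cantor_space -> R).
Proof.
move=> x; apply/cvgrPdist_lt => e e0.
have [n ltn] := mass_tail _ w_ge0 w_fin size _ e0.
have agree : \forall y \near (x : cantor_space), forall i, (i < n)%N -> x i = y i.
  elim: n {ltn} => [|n IHn]; first by near=> y.
  have nearn : \forall y \near (x : cantor_space), x n = y n.
    have := @proj_continuous nat (fun=> bool : topologicalType) n x [set x n].
    by move=> H; near=> y; apply/esym; near: y; apply: H; exact: discrete_set1.
  near=> y => i; rewrite ltnS leq_eqVlt => /predU1P[->|].
    by near: y.
  by move: i; near: y.
near=> y; apply: le_lt_trans ltn; apply: lex_cdf_tail.
by near: y.
Unshelve. all: by end_near. Qed.

Lemma lex_cdf_closed : closed (range f).
Proof.
apply: compact_closed; first exact: Rhausdorff.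
apply: (@continuous_compact cantor_space); last exact: cantor_space_compact.
exact/continuous_subspaceT/lex_cdf_continuous.
Qed.

(** Flipping a far enough bit of x gives a point of the range that is close
    to f(x), and positive weights make it different from f(x). *)
Lemma lex_cdf_perfect : (forall s, 0 < w s) -> perfect (range f).
Proof.
move=> w_gt0; split; first exact: lex_cdf_closed.
apply/seteqP; split=> // _ [/[!inE] -[x _ <-] [V /nbhs_ballP[e /= e0 subV] Vx]].
have [n ltn] := mass_tail _ w_ge0 w_fin size _ e0.
pose y i := if i == n then ~~ x n else x i.
have agree i : i != n -> x i = y i by rewrite /y => /negbTE ->.
have yn : y n = ~~ x n by rewrite /y eqxx.
have : (V `&` range f) (f y).
  split; last by exists y.
  apply: subV; apply: le_lt_trans ltn; apply: lex_cdf_tail => i /ltn_eqF/negbT.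
  exact: agree.
rewrite Vx /= => fyx; case xn: (x n) yn => /= yn.
  have := lex_cdf_flip n y x (fun i ni => esym (agree i ni)) yn xn.
  by rewrite fyx gerDl leNgt w_gt0.
have := lex_cdf_flip n x y agree xn yn.
by rewrite fyx gerDl leNgt w_gt0.
Qed.

(** The closed intervals that start at f(t000...) with length the mass of the
    proper extensions of t, for t of length n, cover the range; as the sets of
    extensions are disjoint, the lengths add up to at most tail(n). *)
Lemma lex_cdf_null : (@lebesgue_measure R).-negligible (range f).
Proof.
have mf : measurable (range f) by apply: closed_measurable; exact: lex_cdf_closed.
apply/negligibleP => //; apply/eqP; rewrite eq_le measure_ge0 andbT.
apply/lee_addgt0Pr => e e0; rewrite add0e.
have [n /ltW ltn] := mass_tail _ w_ge0 w_fin size _ e0.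
pose cyl (t : seq bool) : R :=
  mass w ([set s | (n < size s)%N] `&` [set s | take n s = t]).
apply: (@le_trans _ _ (tail n)%:E); last by rewrite lee_fin.
(* [nth false t] is the sequence t000... *)
pose r := [seq (f (nth false t), cyl t) | t : n.-tuple bool].
apply: (@le_trans _ _ (\sum_(p <- r) p.2)%:E).
  apply: lebesgue_measure_cover => // [p /mapP[t _ ->]|]; first exact: mass_ge0.
  move=> _ [x _ <-]; pose t := [tuple of mkseq x n].
  exists (f (nth false t), cyl t); first by apply/mapP; exists t; rewrite ?mem_enum.
  apply/andP; split=> /=.
    apply: mass_le => // s; apply: lexle_mono => i.
    have [lin|lin] := ltnP i n; first by rewrite nth_mkseq.
    by rewrite nth_default// size_mkseq.
  by apply: lex_cdf_near => i lin; rewrite nth_mkseq.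
rewrite lee_fin big_image /= -(big_map val predT cyl).
apply: (@mass_fibers _ _ w w_ge0 w_fin _ (take n)).
by rewrite map_inj_uniq ?index_enum_uniq//; exact: val_inj.
Qed.
End Image.

Theorem proposition3p7 (R : realType) (U : partial_fun) (hU : optimal R U) :
  (forall x : nat -> bool, (0 <= Omega_le_sum R U x <= 1)%E) /\
  [/\ (@lebesgue_measure R).-negligible (range (Omega_le R U)),
      nowhere_dense (range (Omega_le R U)) &
      perfect (range (Omega_le R U))].
Proof.
have [[_ pfU] _] := hU.
pose w s : R := exp2N (K R U s).
have w_ge0 s : 0 <= w s by exact: exp2N_ge0.
have w_gt0 s : 0 < w s by exact/exp2N_gt0/optimal_K_fin.
have w_fin : (\esum_(s in setT) (w s)%:E < +oo)%E.
  exact: le_lt_trans (kraft_esum R U setT pfU) (ltry _).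
split=> [x|].
  apply/andP; split; last exact: kraft_esum.
  by apply: esum_ge0 => s _; rewrite lee_fin exp2N_ge0.
have -> : Omega_le R U = lex_cdf w by [].
have null := lex_cdf_null w w_ge0 w_fin.
split=> //; last exact: lex_cdf_perfect.
by apply: closed_null_nowhere_dense => //; exact: lex_cdf_closed.
Qed.
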